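(* Let $T$ be a continuous-logic theory in a separable language, and let $\sim$ be an open equivalence relation on models of $T$. Then $T$ admits a definable generalised metric $d$ such that, in every model of $T$, $d(a,b) < \infty$ if and only if $a \sim b$. Moreover, this definable metric is unique up to uniform and coarse equivalence: if $d$ and $d'$ are two such definable generalised metrics, then for every $\varepsilon > 0$ there exists $\delta > 0$ such that for all $x,y$ in models of $T$, $d(x,y) < \delta \Rightarrow d'(x,y) < \varepsilon$ and $d(x,y) > 1/\delta \Rightarrow d'(x,y) > 1/\varepsilon$, and similarly with the roles of $d$ and $d'$ exchanged.
   Context: We work in continuous (metric) logic where formulas may take values in the compact interval $[-\infty,\infty]$ (uniform continuity being understood with respect to this compact interval). $\mathrm{S}_2(T)$ is the compact space of $2$-types of $T$ (in two variables of the home sort). An invariant binary relation on models of $T$ is a set $R\subseteq \mathrm{S}_2(T)$, interpreted in each model $M\models T$ by $R(a,b)$ iff $\mathrm{tp}(a,b)\in R$; it is an invariant equivalence relation if it induces an equivalence relation on every model, and it is open if $R$ is an open subset of $\mathrm{S}_2(T)$. A definable generalised metric is a $[0,\infty]$-valued formula $d(x,y)$ which, in every model of $T$, is a metric except that it may take the value $\infty$. *)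

(* Defs.v *)
From HB Require Import structures.
From mathcomp Require Import all_boot all_order all_algebra.
From mathcomp Require Import all_classical all_reals all_analysis.
Import Order.TTheory GRing.Theory Num.Theory.

Set Implicit Arguments.
Unset Strict Implicit.
Unset Printing Implicit Defensive.

Local Open Scope classical_set_scope.
Local Open Scope ring_scope.

(** Many-sorted continuous logic with truth values in the compact interval
    [\bar R = [-oo, +oo]]. Its uniform structure is the one given by the library
    metric [`|contract x - contract y|], where [contract] is an increasing
    homeomorphism of [\bar R] onto [[-1, 1]]. *)

(** A modulus [m] of a symbol reads: arguments at distance [< m e] have values
    at distance [<= e]. Each sort carries a bound on its diameter. *)
Record language (R : realType) := Language {
  lsort : Type;
  home : lsort;
  diameter : lsort -> R;
  fsymb : Type;
  fdom : fsymb -> seq lsort;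
  fcod : fsymb -> lsort;
  fmodulus : fsymb -> R -> R;
  fmodulus_gt0 : forall f e, 0 < e -> 0 < fmodulus f e;
  psymb : Type;
  pdom : psymb -> seq lsort;
  pmodulus : psymb -> R -> R;
  pmodulus_gt0 : forall P e, 0 < e -> 0 < pmodulus P e
}.

(** Typed de Bruijn variables: [var G s] is the type of the positions of the
    sort [s] in the finite context [G]. *)
Inductive var (S : Type) : seq S -> S -> Type :=
| vz G s : var (s :: G) s
| vs G s t : var G s -> var (t :: G) s.

(** A tuple of elements of [M], indexed by the variables of [G]. *)
Definition env (S : Type) (M : S -> Type) (G : seq S) : Type :=
  forall s, var G s -> M s.

Definition enil (S : Type) (M : S -> Type) : env M [::] :=
  fun s x =>
    match x in var G s' return (if G is [::] then M s' else unit) with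
    | vz _ _ => tt
    | vs _ _ _ _ => tt
    end.

Definition econs (S : Type) (M : S -> Type) (G : seq S) (t : S)
    (a : M t) (v : env M G) : env M (t :: G) :=
  fun s x =>
    match x in var G' s'
      return (if G' is t' :: G'' then M t' -> env M G'' -> M s' else unit) with
    | vz _ _ => fun a _ => a
    | vs _ s' _ y => fun _ v => v s' y
    end a v.

Arguments enil {S} M.
Arguments econs {S} M {G t}.

Definition epair (S : Type) (M : S -> Type) (s t : S) (a : M s) (b : M t) :
    env M [:: s; t] :=
  econs M a (econs M b (enil M)).

Arguments epair {S} M {s t}.

Section Syntax.
Context {R : realType} (L : language R).

Inductive term (G : seq (lsort L)) : lsort L -> Type :=
| TVar s : var G s -> term G s
| TApp (f : fsymb L) : (forall s, var (fdom f) s -> term G s) -> term G (fcod f).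

(** Connectives are the continuous functions of countably many arguments, so
    that formulas are closed under forced uniform limits: they are the definable
    predicates of finitary continuous logic. *)
Inductive formula : seq (lsort L) -> Type :=
| FDist G s : term G s -> term G s -> formula G
| FPred G (P : psymb L) : (forall s, var (pdom P) s -> term G s) -> formula G
| FConn G (u : {ptws nat -> \bar R} -> \bar R) :
    continuous u -> (nat -> formula G) -> formula G
| FSup G s : formula (s :: G) -> formula G
| FInf G s : formula (s :: G) -> formula G.

Definition sentence : Type := formula [::].

(** A theory is a set of closed conditions [phi = 0]. *)
Definition theory : Type := set sentence.

End Syntax.

Arguments term {R} L G _.
Arguments formula {R} L _.

Record structure (R : realType) (L : language R) := Structure {
  carrier :> lsort L -> metricType R;
  carrier_nonempty : forall s, [set: carrier s] !=set0;
  carrier_complete : forall s (F : set_system (carrier s)),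
    ProperFilter F -> cauchy F -> exists a : carrier s, F --> a;
  carrier_bounded : forall s (a b : carrier s), mdist a b <= diameter s;
  finterp : forall f : fsymb L, env carrier (fdom f) -> carrier (fcod f);
  finterp_unif : forall f e, 0 < e -> forall v w : env carrier (fdom f),
    (forall s (x : var (fdom f) s), mdist (v s x) (w s x) < fmodulus f e) ->
    mdist (finterp v) (finterp w) <= e;
  pinterp : forall P : psymb L, env carrier (pdom P) -> \bar R;
  pinterp_unif : forall P e, 0 < e -> forall v w : env carrier (pdom P),
    (forall s (x : var (pdom P) s), mdist (v s x) (w s x) < pmodulus P e) ->
    `|contract (pinterp v) - contract (pinterp w)| <= e
}.

Section Semantics.
Context {R : realType} {L : language R}.
Implicit Types M : structure L.

Fixpoint teval M G (v : env (carrier M) G) s (t : term L G s) : M s :=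
  match t in term _ _ s return M s with
  | TVar s x => v s x
  | TApp f args => finterp (fun s x => teval v (args s x))
  end.

Fixpoint feval M G (phi : formula L G) : env (carrier M) G -> \bar R :=
  match phi in formula _ G return env (carrier M) G -> \bar R with
  | FDist _ _ t1 t2 => fun v => (mdist (teval v t1) (teval v t2))%:E
  | FPred _ P args => fun v => pinterp (fun s x => teval v (args s x))
  | FConn _ u _ phis => fun v => u (fun n => feval (phis n) v)
  | FSup _ s psi => fun v =>
      ereal_sup [set feval psi (econs (carrier M) a v) | a in [set: M s]]
  | FInf _ s psi => fun v =>
      ereal_inf [set feval psi (econs (carrier M) a v) | a in [set: M s]]
  end.

Definition models M (T : theory L) : Prop :=
  forall phi, T phi -> feval phi (enil (carrier M)) = 0%E.

(** A binary formula on the home sort, as a function on each structure. *)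
Definition feval2 M (d : formula L [:: home L; home L]) (a b : M (home L)) :
    \bar R :=
  feval d (epair (carrier M) a b).

(** For each context the formulas form a separable space for the logical
    distance, i.e. the supremum over all [L]-structures and all tuples. *)
Definition separable_language : Prop :=
  forall G : seq (lsort L), exists D : nat -> formula L G,
    forall (phi : formula L G) (e : R), 0 < e ->
    exists n, forall M (v : env (carrier M) G),
      `|contract (feval phi v) - contract (feval (D n) v)| <= e.

End Semantics.

Arguments separable_language {R} L.

Section Types.
Context {R : realType} {L : language R} (T : theory L).

(** A type is identified with the function sending a formula to its value at a
    realisation. The topology is the coarsest making these values continuous. *)
Definition realised_types (G : seq (lsort L)) :
    set {ptws formula L G -> \bar R} :=
  [set p | exists2 M : structure L, models M T &
             exists v : env (carrier M) G, p = (fun phi => feval phi v)].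

Definition type_space (G : seq (lsort L)) : topologicalType :=
  set_type (@realised_types G).

Definition S2 : topologicalType := type_space [:: home L; home L].

Lemma realised_type_mem (M : structure L) (MT : models M T) G
    (v : env (carrier M) G) :
  ((fun phi => feval phi v) : {ptws formula L G -> \bar R})
    \in @realised_types G.
Proof. by apply/mem_set; exists M => //; exists v. Qed.

Definition tp (M : structure L) (MT : models M T) G (v : env (carrier M) G) :
    type_space G :=
  exist (fun p => p \in @realised_types G) _ (realised_type_mem MT v).

Definition tp2 (M : structure L) (MT : models M T) (a b : M (home L)) : S2 :=
  tp MT (epair (carrier M) a b).

Definition invariant_equivalence (E : set S2) : Prop :=
  forall (M : structure L) (MT : models M T),
    [/\ forall a : M (home L), E (tp2 MT a a),
        forall a b : M (home L), E (tp2 MT a b) -> E (tp2 MT b a) &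
        forall a b c : M (home L),
          E (tp2 MT a b) -> E (tp2 MT b c) -> E (tp2 MT a c)].

Definition definable_generalised_metric
    (d : formula L [:: home L; home L]) : Prop :=
  forall M : structure L, models M T ->
    [/\ forall a b : M (home L), (0 <= feval2 d a b)%E,
        forall a b : M (home L), feval2 d a b = 0%E <-> a = b,
        forall a b : M (home L), feval2 d a b = feval2 d b a &
        forall a b c : M (home L),
          (feval2 d a c <= feval2 d a b + feval2 d b c)%E].

Definition finite_exactly_on (d : formula L [:: home L; home L])
    (E : set S2) : Prop :=
  forall (M : structure L) (MT : models M T) (a b : M (home L)),
    (feval2 d a b < +oo)%E <-> E (tp2 MT a b).

Definition unif_coarse_controls (d d' : formula L [:: home L; home L]) : Prop :=
  forall e : R, 0 < e -> exists2 delta : R, 0 < delta &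
    forall M : structure L, models M T -> forall x y : M (home L),
      ((feval2 d x y < delta%:E)%E -> (feval2 d' x y < e%:E)%E) /\
      ((feval2 d x y > (1 / delta)%:E)%E -> (feval2 d' x y > (1 / e)%:E)%E).

End Types.

(* Main.v *)
(** With N large enough that (1 + N) dist(a,b) < 1 forces phi(a,b) <= N, where phi is
    a [0,oo]-valued formula finite exactly on E, the formula
    rho(a,b) = (1 + N) dist(a,b) + (max(phi(a,b), phi(b,a), N) - N) is finite
    exactly on E and is a multiple of dist wherever that multiple is < 1. The
    metric is the chain infimum of rho. Two consecutive links either have total
    cost >= 1 or can be merged into one link without increasing the cost, so
    chains of cost < n + 1 can be taken of length bounded in terms of n; this
    makes the infimum over all lengths a uniform limit of formulas. Existence of
    N and uniqueness are compactness statements about types over T, which are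
    obtained from ultraproducts of sequences of models. *)

Require Import Defs.
From HB Require Import structures.
From mathcomp Require Import all_boot all_order all_algebra.
From mathcomp Require Import all_classical all_reals all_analysis.
From mathcomp Require Import lra.
Import Order.TTheory GRing.Theory Num.Theory.
Import numFieldNormedType.Exports.

Set Implicit Arguments.
Unset Strict Implicit.
Unset Printing Implicit Defensive.

Local Open Scope classical_set_scope.
Local Open Scope ring_scope.

(** The formula phi comes from separability: the values of countably many dense formulas place the
    types in a metrisable cube, and phi is the closeness to the complement of E in that cube,
    stretched so that its maximal value 1 becomes +oo. Such a phi obeys no triangle inequality.
    Subtracting N erases it near the diagonal and leaves only the multiple of dist, whose own
    triangle inequality is what makes two cheap links mergeable. An infimum of infinitely many
    formulas is in general not a continuous connective. The length bound allows the n-th term to be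
    replaced by its maximum with n without changing the infimum, and then only finitely many terms
    matter up to a given precision. The three laws of E enter separately: reflexivity bounds phi
    near the diagonal, symmetry keeps the maximum over both orders finite on E, transitivity keeps
    chains of finite cost inside one class. Sequences of models suffice because each compactness
    statement asks for a natural number, so its failure yields one counterexample for each n. *)

(** * Extended reals and pointwise convergence *)

Lemma ultra_fmap (T S : Type) (f : T -> S) (U : set_system T) :
  UltraFilter U -> UltraFilter (f @ U).
Proof.
move=> UU; apply: Build_UltraFilter => G PG sUG.
apply/seteqP; split=> // A GA.
have [//|UnA] := in_ultra_setVsetC (f @^-1` A) UU.
have : G (A `&` ~` A) by apply: filterI => //; exact: sUG.
by rewrite setICr => G0; case: (@filter_not_empty _ G PG G0).
Qed.

Lemma cvg_initialP (S : choiceType) (T : topologicalType) (f : S -> T)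
    (F : set_system S) (FF : Filter F) (s : S) :
  F --> (s : initial_topology f) <-> f @ F --> f s.
Proof.
split=> [Fs A fsA|fFs A].
  by apply: Fs; exact: (@initial_continuous S T f s A fsA).
rewrite /= nbhsE => -[_ [[B Bop <-] Bfs] sBA].
rewrite nbhs_filterE; apply: filterS sBA _; apply: fFs.
exact: open_nbhs_nbhs.
Qed.

Lemma cvg_ptwsP (I : Type) (V : topologicalType)
    (F : set_system {ptws I -> V}) (FF : Filter F) (f : {ptws I -> V}) :
  F --> f <-> forall t, (fun g => g t) @ F --> f t.
Proof.
rewrite cvg_sup; split => H i; have := H i.
  by move=> /(@cvg_initialP _ V (fun g : {ptws I -> V} => g i) F).
by move=> /(@cvg_initialP _ V (fun g : {ptws I -> V} => g i) F).
Qed.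

Lemma ptws_proj_cvg (I : Type) (V : topologicalType) (f : {ptws I -> V}) i :
  (fun g : {ptws I -> V} => g i) @ f --> f i.
Proof. by have /cvg_ptwsP : f --> f by []. Qed.

Section ExtendedReals.
Context {R : realType}.
Implicit Types x y l : \bar R.

Lemma cvge_contractP (T : Type) (F : set_system T) (FF : Filter F)
    (f : T -> \bar R) l :
  f @ F --> l <->
  forall e, 0 < e -> \forall t \near F, `|contract l - contract (f t)| < e.
Proof. exact: cvg_ballP. Qed.

Lemma contract_cvg (T : Type) (F : set_system T) {FF : Filter F}
    (f : T -> \bar R) l :
  f @ F --> l -> contract (f t) @[t --> F] --> contract l.
Proof. by move=> /cvge_contractP fl; apply/cvgrPdist_lt. Qed.

Lemma ultra_cvg_real (T : Type) (U : set_system T) (UU : UltraFilter U)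
  (f : T -> R) (a b : R) : (forall t, a <= f t <= b) -> exists r : R, f @ U --> r.
Proof.
move=> fab; have := @segment_compact R a b; rewrite compact_ultra => /(_ (f @ U)).
case; first exact: ultra_fmap.
  by apply: nearW => t /=; rewrite in_itv/= fab.
by move=> l [_ ?]; exists l.
Qed.

Lemma contract_itv x : -1 <= contract x <= 1.
Proof. by rewrite -ler_norml contract_le1. Qed.

Lemma ultra_cvg_ereal (T : Type) (U : set_system T) (UU : UltraFilter U)
  (f : T -> \bar R) : exists l, f @ U --> l.
Proof.
have [r fr] := ultra_cvg_real UU (fun t => contract_itv (f t)).
have r1 : `|r| <= 1.
  rewrite ler_norml; apply/andP; split.
    apply: (cvgr_to_ge fr); apply: nearW => t; by have /andP[] := contract_itv (f t).
  apply: (cvgr_to_le fr); apply: nearW => t; by have /andP[] := contract_itv (f t).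
exists (expand r); apply/cvge_contractP => e e0; rewrite expandK//.
by move/cvgrPdist_lt : fr; exact.
Qed.

Lemma cvg_ereal_unique (T : Type) (F : set_system T) (PF : ProperFilter F)
    (f : T -> \bar R) l l' : f @ F --> l -> f @ F --> l' -> l = l'.
Proof. by move=> fl fl'; apply: (cvg_unique (@ereal_hausdorff R) fl fl'). Qed.

Lemma lee_cvg_filter (T : Type) (F : set_system T) {PF : ProperFilter F}
    (f g : T -> \bar R) x y :
  f @ F --> x -> g @ F --> y -> (\forall t \near F, (f t <= g t)%E) ->
  (x <= y)%E.
Proof.
move=> /contract_cvg fx /contract_cvg gy fg.
rewrite -le_contract -subr_ge0; apply: (cvgr_to_ge (cvgB gy fx)).
by apply: filterS fg => t; rewrite subr_ge0 le_contract.
Qed.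

Lemma ereal_dense x y : (x < y)%E -> exists2 z : \bar R, (x < z)%E & (z < y)%E.
Proof.
rewrite -lt_contract => xy; pose r := (contract x + contract y) / 2.
have [/andP[x1 _] /andP[_ y1]] := (contract_itv x, contract_itv y).
have r1 : `|r| <= 1 by rewrite ler_norml /r; apply/andP; split; lra.
by exists (expand r); rewrite -lt_contract expandK// /r; lra.
Qed.

Lemma maxe_cvg (T : Type) (F : set_system T) {FF : Filter F}
    (f g : T -> \bar R) x y :
  f @ F --> x -> g @ F --> y -> maxe (f t) (g t) @[t --> F] --> maxe x y.
Proof.
move=> /cvge_contractP fx /cvge_contractP gy; apply/cvge_contractP => e e0.
have cmax u v : contract (maxe u v) = Num.max (contract u) (contract v) :> R.
  by rewrite /maxe /Num.max /Order.max lt_contract; case: ifP.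
apply: filterS2 (fx e e0) (gy e e0) => t.
rewrite !cmax => /ltr_normlP[A1 A2] /ltr_normlP[A3 A4]; apply/ltr_normlP.
rewrite /Num.max; case: (ltP (contract x)) => ?; case: (ltP (contract (f t))) => ?; split; lra.
Qed.

End ExtendedReals.

(** * Quotient of a pseudometric space *)

Record pseudometric (R : realType) (X : Type) := Pseudometric {
  pdist :> X -> X -> R;
  pdistxx : forall x, pdist x x = 0;
  pdistC : forall x y, pdist x y = pdist y x;
  pdist_triangle : forall y x z, pdist x z <= pdist x y + pdist y z
}.

Section MetricIdentification.
Context {R : realType} (X : Type) (d : pseudometric R X).

(** Points are the classes themselves, as subsets of [X], so that distance 0 becomes equality by
    extensionality; representatives are recovered by choice in [mrepr]. *)
Definition metric_id : Type :=
  {A : set X | exists x, A = [set y | d x y = 0]}.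

HB.instance Definition _ := gen_eqMixin metric_id.
HB.instance Definition _ := gen_choiceMixin metric_id.

Definition mclass (x : X) : metric_id :=
  exist _ [set y | d x y = 0] (ex_intro _ x erefl).

Definition mrepr (q : metric_id) : X := sval (cid (svalP q)).

Lemma pdist_ge0 x y : 0 <= d x y.
Proof.
have := pdist_triangle d y x x.
by rewrite pdistxx (pdistC d y x) -mulr2n pmulrn_lge0.
Qed.

Lemma pdist_eq0l x y z : d x y = 0 -> d x z = d y z.
Proof.
move=> xy0; apply/eqP; rewrite eq_le.
have := pdist_triangle d y x z; have := pdist_triangle d x y z.
by rewrite (pdistC d y x) xy0 !add0r => -> ->.
Qed.

Lemma eq_mclass x y : d x y = 0 -> mclass x = mclass y.
Proof.
by move=> xy0; apply: eq_exist; apply/seteqP; split=> z /=; rewrite (pdist_eq0l z xy0).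
Qed.

Lemma mreprK q : mclass (mrepr q) = q.
Proof.
rewrite /mrepr; case: cid => x /= qx; case: q qx => A Ax /= AE.
exact: eq_exist.
Qed.

Lemma mclassK x : d x (mrepr (mclass x)) = 0.
Proof.
have := congr1 sval (mreprK (mclass x)); rewrite /= => /seteqP[+ _].
by move=> /(_ (mrepr (mclass x))); apply; exact: pdistxx.
Qed.

Definition metric_id_dist (p q : metric_id) : R := d (mrepr p) (mrepr q).

Lemma metric_id_distE x y : metric_id_dist (mclass x) (mclass y) = d x y.
Proof.
by rewrite /metric_id_dist -(pdist_eq0l _ (mclassK x)) pdistC
  -(pdist_eq0l _ (mclassK y)) pdistC.
Qed.

Lemma metric_id_distxx p : metric_id_dist p p = 0.
Proof. exact: pdistxx. Qed.

Lemma metric_id_dist_eq0 p q : metric_id_dist p q = 0 -> p = q.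
Proof. by move=> /eq_mclass; rewrite !mreprK. Qed.

Lemma metric_id_distC p q : metric_id_dist p q = metric_id_dist q p.
Proof. exact: pdistC. Qed.

Lemma metric_id_dist_triangle q p r :
  metric_id_dist p r <= metric_id_dist p q + metric_id_dist q r.
Proof. exact: pdist_triangle. Qed.

HB.instance Definition _ := isMetric.Build R metric_id
  metric_id_distxx metric_id_dist_eq0 metric_id_distC metric_id_dist_triangle.

Lemma mdist_mclass x y : mdist (mclass x) (mclass y) = d x y.
Proof. exact: metric_id_distE. Qed.

End MetricIdentification.

(** * Typed variables and environments *)

Section Variables.
Context {S : Type}.

(** The return type of the match computes on the shape of the context, so the index [t :: G] is
    inverted without equality proofs between sorts. *)
Definition var_cons_rect (t : S) (G : seq S)
    (Q : forall s, var (t :: G) s -> Type)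
    (Q0 : Q t (@vz S G t)) (QS : forall s (x : var G s), Q s (vs t x))
    s (x : var (t :: G) s) : Q s x :=
  match x as x0 in var G' s'
    return (if G' is t' :: G'' return var G' s' -> Type then
      fun x1 => forall Q : forall s, var (t' :: G'') s -> Type,
        Q t' (@vz S G'' t') -> (forall s (x : var G'' s), Q s (vs t' x)) ->
        Q s' x1
    else fun=> unit) x0 with
  | vz _ _ => fun Q Q0 _ => Q0
  | vs _ _ _ y => fun Q _ QS => QS _ y
  end Q Q0 QS.

Lemma var_nil s : var (@nil S) s -> False.
Proof.
move=> x; exact: (match x in var G' s' return
  (if G' is [::] then False else True) with vz _ _ => I | vs _ _ _ _ => I end).
Qed.

(** A context has finitely many variables, so only finitely many sets of the filter are
    intersected. *)
Lemma near_env (I : Type) (F : set_system I) (FF : Filter F) (G : seq S)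
    (P : forall s, var G s -> I -> Prop) :
  (forall s x, \forall i \near F, P s x i) ->
  \forall i \near F, forall s x, P s x i.
Proof.
elim: G P => [|t G IH] P PF.
  by apply: nearW => i s x; case: (var_nil x).
have PS : \forall i \near F, forall s (x : var G s), P s (vs t x) i.
  by apply: (IH (fun s x => P s (vs t x))) => s x; exact: PF.
apply: filterS2 (PF t (@vz S G t)) PS => i P0 PSi s x.
by elim/var_cons_rect : x.
Qed.

Lemma env_ext (M : S -> Type) (G : seq S) (v w : env M G) :
  (forall s x, v s x = w s x) -> v = w.
Proof. by move=> vw; apply/functional_extensionality_dep => s; apply/funext. Qed.

Lemma env_nil (M : S -> Type) (v : env M [::]) : v = enil M.
Proof. by apply: env_ext => s x; case: (var_nil x). Qed.

Lemma env_cons (M : S -> Type) t (G : seq S) (v : env M (t :: G)) :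
  v = econs M (v t (@vz S G t)) (fun s x => v s (vs t x)).
Proof. by apply: env_ext => s x; elim/var_cons_rect : x. Qed.

Lemma env_pair (M : S -> Type) s t (v : env M [:: s; t]) :
  v = epair M (v s (@vz _ _ _)) (v t (vs _ (@vz _ _ _))).
Proof. by rewrite [LHS]env_cons [X in econs _ _ X]env_cons [X in econs _ _ (econs _ _ X)]env_nil. Qed.

End Variables.

(** * Ultraproducts *)

Section Ultraproduct.
Context {R : realType} {L : language R} (M : nat -> structure L)
  (U : set_system nat) {UU : UltraFilter U} (oU : \oo `<=` U).

#[local] Instance U_proper : ProperFilter U := ultra_proper.

Definition uprod (s : lsort L) : Type := forall i, M i s.

Definition uprod_dist s (x y : uprod s) : R :=
  lim (mdist (x i) (y i) @[i --> U]).

(** The diameter bound of the sort puts all coordinate distances in one compact interval, so the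
    [lim] in [uprod_dist] is a genuine limit and not a default value. *)
Lemma uprod_dist_cvg s (x y : uprod s) :
  mdist (x i) (y i) @[i --> U] --> uprod_dist x y.
Proof.
have [|r xr] := @ultra_cvg_real R nat U UU (fun i => mdist (x i) (y i))
  0 (diameter s).
  by move=> i; rewrite mdist_ge0 carrier_bounded.
by apply: cvgP xr.
Qed.

Lemma uprod_distE s (x y : uprod s) r :
  mdist (x i) (y i) @[i --> U] --> r -> uprod_dist x y = r.
Proof. by move=> xr; apply: cvg_lim. Qed.

Lemma uprod_distxx s (x : uprod s) : uprod_dist x x = 0.
Proof.
apply: uprod_distE; under eq_fun do rewrite mdistxx.
exact: cvg_cst.
Qed.

Lemma uprod_distC s (x y : uprod s) : uprod_dist x y = uprod_dist y x.
Proof.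
apply: uprod_distE; under eq_fun do rewrite metric_sym.
exact: uprod_dist_cvg.
Qed.

Lemma uprod_dist_triangle s (y x z : uprod s) :
  uprod_dist x z <= uprod_dist x y + uprod_dist y z.
Proof.
rewrite -subr_ge0.
have xyz : (mdist (x i) (y i) + mdist (y i) (z i)) - mdist (x i) (z i) @[i --> U]
    --> (uprod_dist x y + uprod_dist y z) - uprod_dist x z.
  by apply: cvgB; [apply: cvgD|]; exact: uprod_dist_cvg.
apply: (cvgr_to_ge xyz).
by apply: nearW => i; rewrite subr_ge0; exact: metric_triangle.
Qed.

Definition uprod_pseudometric s : pseudometric R (uprod s) :=
  Pseudometric (@uprod_distxx s) (@uprod_distC s) (@uprod_dist_triangle s).

Definition ultra_carrier (s : lsort L) : metricType R :=
  metric_id (uprod_pseudometric s).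

Definition uclass s (x : uprod s) : ultra_carrier s :=
  mclass (uprod_pseudometric s) x.
Definition urepr s (q : ultra_carrier s) : uprod s := mrepr q.

Lemma ureprK s (q : ultra_carrier s) : uclass (urepr q) = q.
Proof. exact: mreprK. Qed.

Lemma mdist_uclass s (x y : uprod s) :
  mdist (uclass x) (uclass y) = uprod_dist x y.
Proof. exact: mdist_mclass. Qed.

Lemma uclass_cvg s (x y : uprod s) :
  mdist (x i) (y i) @[i --> U] --> mdist (uclass x) (uclass y).
Proof. by rewrite mdist_uclass; exact: uprod_dist_cvg. Qed.

Lemma urepr_cvg s (p q : ultra_carrier s) :
  mdist (urepr p i) (urepr q i) @[i --> U] --> mdist p q.
Proof. by rewrite -{2}(ureprK p) -{2}(ureprK q); exact: uclass_cvg. Qed.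

Lemma ultra_carrier_nonempty s : [set: ultra_carrier s] !=set0.
Proof.
exists (uclass (fun i => sval (cid (@carrier_nonempty _ _ (M i) s)))) => //.
Qed.

Lemma ultra_carrier_bounded s (p q : ultra_carrier s) :
  mdist p q <= diameter s.
Proof.
apply: (cvgr_to_le (@urepr_cvg s p q)); apply: nearW => i; exact: carrier_bounded.
Qed.

Lemma geometric_chain (X : metricType R) (x : nat -> X) n k :
  (n <= k)%N -> (forall m, (m < k)%N -> mdist (x m) (x m.+1) <= 2^-1 ^+ m) ->
  mdist (x n) (x k) <= 2 * 2^-1 ^+ n.
Proof.
move=> nk xk.
(* The exact geometric sum is the form that passes through the induction on [k]. *)
suff : mdist (x n) (x k) <= 2 * (2^-1 ^+ n - 2^-1 ^+ k).
  have : 0 <= 2^-1 ^+ k :> R by rewrite exprn_ge0// invr_ge0.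
  by lra.
elim: k nk xk => [|k IH]; first by rewrite leqn0 => /eqP ->; rewrite mdistxx subrr mulr0.
rewrite leq_eqVlt => /predU1P[-> _|nk xk]; first by rewrite mdistxx subrr mulr0.
apply: le_trans (metric_triangle _ (x k) _) _.
have h1 := IH nk (fun m mk => xk m (ltnW mk)).
have := xk k (ltnSn k); rewrite exprS; lra.
Qed.

(* The [i]-th coordinate of the limit of a fast Cauchy sequence is read off from
   the last term of index at most [i] before which the [i]-th coordinates behave:
   no completeness of the factors is involved. *)
Lemma uprod_complete s (x : nat -> uprod s) :
  (forall n, uprod_dist (x n) (x n.+1) < 2^-1 ^+ n) ->
  exists y, forall n, uprod_dist (x n) y <= 2 * 2^-1 ^+ n.
Proof.
move=> xC.
pose good i n := forall m, (m < n)%N -> mdist (x m i) (x m.+1 i) <= 2^-1 ^+ m.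
have maxgood i j : exists k, good i k /\
    forall n, (n <= j)%N -> good i n -> (n <= k)%N.
  elim: j => [|j [k [ik kmax]]].
    by exists 0; split=> // n; rewrite leqn0 => /eqP ->.
  have [gj|ngj] := pselect (good i j.+1).
    by exists j.+1.
  exists k; split=> // n; rewrite leq_eqVlt => /predU1P[->//|]; exact: kmax.
pose k i := sval (cid (maxgood i i)).
exists (fun i => x (k i) i) => n.
apply: (cvgr_to_le (@uprod_dist_cvg s (x n) _)).
have goodn : \forall i \near U, good i n.
  elim: n => [|n IH]; first by apply: nearW => i m.
  have xn : \forall i \near U, mdist (x n i) (x n.+1 i) < 2^-1 ^+ n.
    exact: (cvgr_lt _ (@uprod_dist_cvg s (x n) (x n.+1))).
  apply: filterS2 IH xn => i gi xni m; rewrite ltnS leq_eqVlt => /predU1P[->|].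
    exact: ltW.
  exact: gi.
have Un : \forall i \near U, (n <= i)%N by apply: oU; exists n.
apply: filterS2 goodn Un => i gi ni.
rewrite /k; case: cid => /= l [gl lmax].
exact: (@geometric_chain _ (fun m => x m i)) (lmax _ ni gi) gl.
Qed.

Lemma ultra_carrier_complete s (F : set_system (ultra_carrier s)) :
  ProperFilter F -> cauchy F -> exists a : ultra_carrier s, F --> a.
Proof.
move=> PF FC.
have half_gt0 n : 0 < 2^-1 ^+ n :> R by rewrite exprn_gt0// invr_gt0.
(* The radii are halved so that consecutive centres, whose balls meet, lie at distance less than
   [2^-1 ^+ n], as [uprod_complete] demands. *)
have Fq n : exists q : ultra_carrier s, F (ball q (2^-1 ^+ n / 2)).
  by apply: (cauchyP F).1 FC _ _; rewrite divr_gt0.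
have [q qF] := choice Fq.
have qq n : mdist (q n) (q n.+1) < 2^-1 ^+ n.
  have [p []] := filter_ex (filterI (qF n) (qF n.+1)).
  rewrite !ballEmdist/= => np np1.
  apply: le_lt_trans (metric_triangle _ p _) _.
  move: np np1; rewrite (metric_sym (q n.+1)) exprS.
  by have := half_gt0 n; lra.
have [|y ylim] := @uprod_complete s (fun n => urepr (q n)).
  by move=> n; rewrite -mdist_uclass !ureprK.
exists (uclass y); apply/fcvg_ballP => e e0.
(* Twice [2^-1 ^+ n] is for the distance from the limit to [q n], and once more covers the ball
   around [q n]. *)
have [n ne] : exists n, 3 * 2^-1 ^+ n < e.
  have h : 3 * 2^-1 ^+ n @[n --> \oo] --> (3 * 0 : R).
    by apply: cvgMl_tmp; apply: cvg_expr; rewrite ger0_norm ?invr_ge0// invf_lt1 ?ltr1n.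
  rewrite mulr0 in h.
  by have [n _ /(_ n (leqnn n))] := cvgr_lt _ h _ e0; exists n.
apply: filterS (qF n) => p; rewrite !ballEmdist/= => np.
apply: le_lt_trans (metric_triangle _ (q n) _) _.
have := ylim n; rewrite -mdist_uclass ureprK.
rewrite (metric_sym _ (uclass y)); have := half_gt0 n; lra.
Qed.

Lemma ex_ulim (f : nat -> \bar R) : exists l : \bar R, f @ U --> l.
Proof. exact: ultra_cvg_ereal. Qed.

Definition ulim (f : nat -> \bar R) : \bar R := sval (cid (ex_ulim f)).

Lemma ulimP f : f @ U --> ulim f.
Proof. by rewrite /ulim; case: cid. Qed.

Definition ultra_finterp (f : fsymb L) (v : env ultra_carrier (fdom f)) :
    ultra_carrier (fcod f) :=
  uclass (fun i => finterp (fun s x => urepr (v s x) i)).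

Definition ultra_pinterp (P : psymb L) (v : env ultra_carrier (pdom P)) :
    \bar R :=
  ulim (fun i => pinterp (fun s x => urepr (v s x) i)).

Lemma near_urepr_lt (G : seq (lsort L)) (v w : env ultra_carrier G) e :
  (forall s x, mdist (v s x) (w s x) < e) ->
  \forall i \near U, forall s x, mdist (urepr (v s x) i) (urepr (w s x) i) < e.
Proof.
move=> vw; apply: near_env => s x.
exact: (cvgr_lt _ (@urepr_cvg s (v s x) (w s x))).
Qed.

(** The moduli survive because their premise is strict, hence holds on almost all coordinates, while
    their conclusion is a weak inequality, hence passes to the limit. *)
Lemma ultra_finterp_unif f e : 0 < e -> forall v w,
  (forall s x, mdist (v s x) (w s x) < fmodulus f e) ->
  mdist (@ultra_finterp f v) (ultra_finterp w) <= e.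
Proof.
move=> e0 v w vw; apply: (cvgr_to_le (@uclass_cvg _ _ _)).
by apply: filterS (near_urepr_lt vw) => i vwi; exact: finterp_unif.
Qed.

Lemma ultra_pinterp_unif P e : 0 < e -> forall v w,
  (forall s x, mdist (v s x) (w s x) < pmodulus P e) ->
  `|contract (@ultra_pinterp P v) - contract (ultra_pinterp w)| <= e.
Proof.
move=> e0 v w vw.
have vwU : `|contract (pinterp (fun s x => urepr (v s x) i)) -
    contract (pinterp (fun s x => urepr (w s x) i))| @[i --> U] -->
    `|contract (@ultra_pinterp P v) - contract (ultra_pinterp w)|.
  by apply: cvg_norm; apply: cvgB; apply: contract_cvg; exact: ulimP.
apply: (cvgr_to_le vwU).
by apply: filterS (near_urepr_lt vw) => i vwi; exact: pinterp_unif.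
Qed.

Definition ultraproduct : structure L :=
  Structure ultra_carrier_nonempty ultra_carrier_complete ultra_carrier_bounded
    ultra_finterp_unif ultra_pinterp_unif.

End Ultraproduct.

(** * The theorem of Los for continuous formulas *)

Section Los.
Context {R : realType} {L : language R} (M : nat -> structure L)
  (U : set_system nat) {UU : UltraFilter U} (oU : \oo `<=` U).

#[local] Instance Los_proper : ProperFilter U := ultra_proper.

Let N : structure L := ultraproduct M oU.

Definition uenv (G : seq (lsort L)) (v : forall i, env (carrier (M i)) G) : env (carrier N) G :=
  fun s x => @uclass R L M U UU s (fun i => v i s x).

Lemma uenv_cons G t (v : forall i, env (carrier (M i)) G) (a : forall i, M i t) :
  uenv (fun i => econs (carrier (M i)) (a i) (v i)) =
  econs (carrier N) (@uclass R L M U UU t a) (uenv v).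
Proof. by apply: env_ext; apply: var_cons_rect. Qed.

(** Symbols are interpreted on chosen representatives, which agree with a given family only up to a
    distance tending to 0 along [U]; the moduli of the symbols absorb this error. *)
Lemma near_uclassK G (v : forall i, env (carrier (M i)) G) e : 0 < e ->
  \forall i \near U, forall s x,
    mdist (urepr (uenv v x) i) (v i s x) < e.
Proof.
move=> e0; apply: near_env => s x.
have h := @uprod_dist_cvg _ _ M U UU s (urepr (uenv v x)) (fun i => v i s x).
apply: (cvgr_lt _ h); rewrite -mdist_uclass ureprK.
by rewrite [X in X < _](_ : _ = 0)// mdistxx.
Qed.

Lemma finterp_uenv f (v : forall i, env (carrier (M i)) (fdom f)) :
  finterp (uenv v) = @uclass R L M U UU (fcod f) (fun i => finterp (v i)).
Proof.
apply: eq_mclass; apply/eqP; rewrite eq_le pdist_ge0 andbT.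
apply/ler_addgt0Pl => e e0; rewrite addr0.
apply: (cvgr_to_le (@uprod_dist_cvg _ _ M U UU _ _ _)).
have := near_uclassK v (fmodulus_gt0 f e0); apply: filterS => i vi.
exact: finterp_unif.
Qed.

Lemma pinterp_uenv P (v : forall i, env (carrier (M i)) (pdom P)) :
  pinterp (v i) @[i --> U] --> pinterp (uenv v : env (carrier N) (pdom P)).
Proof.
apply/cvge_contractP => e e0; have e2 : 0 < e / 2 by rewrite divr_gt0.
have lim_w : pinterp (fun s x => urepr (uenv v x) i) @[i --> U] -->
    pinterp (uenv v : env (carrier N) (pdom P)) by exact: ulimP.
move/cvge_contractP : lim_w => /(_ _ e2).
apply: filterS2 (near_uclassK v (pmodulus_gt0 P e2)) => i vi h2.
have h1 := pinterp_unif e2 vi.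
apply: le_lt_trans (ler_distD
  (contract (pinterp (fun s x => urepr (uenv v x) i))) _ _) _.
by rewrite [e]splitr ltr_leD.
Qed.

Lemma teval_uenv G (v : forall i, env (carrier (M i)) G) s (t : term L G s) :
  teval (uenv v) t = @uclass R L M U UU s (fun i => teval (v i) t).
Proof.
elim: t => [//|f args IH] /=.
rewrite (_ : (fun s x => teval (uenv v) (args s x)) =
  uenv (fun i s x => teval (v i) (args s x))); first exact: finterp_uenv.
by apply: env_ext => s0 x; exact: IH.
Qed.

(** By compactness the suprema have some limit [l] along [U]. Every point of the ultraproduct is the
    class of a family, which gives one inequality; for the other, nearly optimal witnesses chosen
    coordinatewise form a single point. *)
Lemma ereal_sup_cvg G t (g : forall i, env (carrier (M i)) (t :: G) -> \bar R)
    (h : env (carrier N) (t :: G) -> \bar R) (v : forall i, env (carrier (M i)) G) :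
  (forall w : forall i, env (carrier (M i)) (t :: G), g i (w i) @[i --> U] --> h (uenv w)) ->
  ereal_sup [set g i (econs (carrier (M i)) a (v i)) | a in [set: M i t]] @[i --> U] -->
  ereal_sup [set h (econs (carrier N) a (uenv v)) | a in [set: N t]].
Proof.
move=> gh; have [l lim_l] := @ultra_cvg_ereal R nat U UU
  (fun i => ereal_sup [set g i (econs (carrier (M i)) a (v i)) | a in [set: M i t]]).
suff -> : ereal_sup [set h (econs (carrier N) a (uenv v)) | a in [set: N t]] = l by [].
apply/eqP; rewrite eq_le; apply/andP; split.
  apply: ge_ereal_sup => _ [a _ <-]; rewrite -(ureprK a) -uenv_cons.
  have lim_a := gh (fun i => econs (carrier (M i)) (urepr a i) (v i)).
  apply: (lee_cvg_filter lim_a lim_l); apply: nearW => i.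
  by apply: ereal_sup_ubound; exists (urepr a i).
rewrite leNgt; apply/negP => /ereal_dense[r Sr rl].
have big : \forall i \near U, exists a : M i t,
    (r < g i (econs (carrier (M i)) a (v i)))%E.
  have lim_r : \forall i \near U,
      (r < ereal_sup [set g i (econs (carrier (M i)) a (v i)) | a in [set: M i t]])%E.
    exact: (lim_l _ (open_ereal_gt' rl)).
  apply: filterS lim_r => i /ereal_sup_gt[_ [a _ <-]] ra.
  by exists a.
(* On coordinates without a witness, any point of the nonempty sort is taken. *)
have [a ar] : exists a : forall i, M i t, \forall i \near U,
    (r < g i (econs (carrier (M i)) (a i) (v i)))%E.
  pose a i : M i t := if pselect (exists a : M i t,
      (r < g i (econs (carrier (M i)) a (v i)))%E) is left ex then sval (cid ex)
    else sval (cid (@carrier_nonempty _ _ (M i) t)).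
  exists a; apply: filterS big => i ex.
  by rewrite /a; case: pselect => // {}ex; case: cid.
have : (r <= h (uenv (fun i => econs (carrier (M i)) (a i) (v i))))%E.
  have lim_a := gh (fun i => econs (carrier (M i)) (a i) (v i)).
  by apply: (lee_cvg_filter (cvg_cst r) lim_a); apply: filterS ar => i /ltW.
apply/negP; rewrite -ltNge uenv_cons; apply: le_lt_trans Sr.
by apply: ereal_sup_ubound; exists (@uclass R L M U UU t a).
Qed.

Theorem Los G (phi : formula L G) (v : forall i, env (carrier (M i)) G) :
  feval phi (v i) @[i --> U] --> feval phi (uenv v).
Proof.
elim: phi v => {G} [G s t1 t2|G P args|G u uC phis IH|G s psi IH|G s psi IH] v /=.
- rewrite !teval_uenv; apply: cvg_EFin; first exact: nearW.
  exact: uclass_cvg.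
- rewrite (_ : (fun s x => teval (uenv v) (args s x)) =
    uenv (fun i s x => teval (v i) (args s x))); first exact: pinterp_uenv.
  by apply: env_ext => s x; exact: teval_uenv.
(* Connectives of infinite arity cause no trouble: they are continuous for the product topology,
   where convergence is coordinatewise. *)
- apply: (cvg_comp (fun i n => feval (phis n) (v i)) u); last exact: uC.
  by apply/cvg_ptwsP => n; exact: IH.
- exact: (ereal_sup_cvg (g := fun i => @feval _ _ _ _ psi)).
- have infE (X : structure L) (w : env (carrier X) G) :
      ereal_inf [set feval psi (econs (carrier X) a w) | a in [set: X s]] =
      (- ereal_sup [set - feval psi (econs (carrier X) a w) | a in [set: X s]])%E.
    by rewrite ereal_infEN image_comp.
  under eq_fun do rewrite infE.
  rewrite [in nbhs _](infE N); apply: cvgeN.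
  apply: (ereal_sup_cvg (g := fun i w => (- feval psi w)%E)
    (h := fun w => (- feval psi w)%E)) => w.
  exact/cvgeN/IH.
Qed.

Lemma models_ultraproduct (T : theory L) : (forall i, models (M i) T) -> models N T.
Proof.
move=> MT phi Tphi; rewrite -(env_nil (uenv (fun i => enil (carrier (M i))))).
have := @Los [::] phi (fun i => enil (carrier (M i))).
under eq_fun do rewrite MT//.
by move=> /cvg_ereal_unique; apply; exact: cvg_cst.
Qed.

Lemma uenv_pair s t (a : forall i, M i s) (b : forall i, M i t) :
  uenv (fun i => epair (carrier (M i)) (a i) (b i)) =
  epair (carrier N) (@uclass R L M U UU s a) (@uclass R L M U UU t b).
Proof. by rewrite [LHS]env_pair. Qed.

End Los.

Section SequentialCompactness.
Context {R : realType} {L : language R} (T : theory L).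
Let H := [:: home L; home L].

(** This serves as compactness of the space of 2-types: the limit pair lives in the ultraproduct
    along an ultrafilter refining [\oo], and weak inequalities between values of formulas pass to
    it. *)
Theorem sequential_compactness (Q : nat -> forall M : structure L,
    M (home L) -> M (home L) -> Prop) :
  (forall n, exists2 M : structure L, models M T & exists a b, Q n M a b) ->
  exists (M : nat -> structure L) (a b : forall n, M n (home L))
    (U : set_system nat) (N : structure L) (c e : N (home L)),
  [/\ UltraFilter U, \oo `<=` U, forall n, models (M n) T /\ Q n (M n) (a n) (b n),
    models N T & forall phi : formula L H,
      feval2 phi (a n) (b n) @[n --> U] --> feval2 phi c e].
Proof.
move=> QM.
have QM' n : exists M : structure L, models M T /\ exists a b, Q n M a b.
  by have [M] := QM n; exists M.
have [M MP] := choice QM'.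
have ab n : exists ab : M n (home L) * M n (home L), Q n (M n) ab.1 ab.2.
  by have [_ [a [b]]] := MP n; exists (a, b).
pose a n := (sval (cid (ab n))).1; pose b n := (sval (cid (ab n))).2.
have [U [UU oU]] := @ultraFilterLemma nat \oo _.
exists M, a, b, U, (ultraproduct M oU).
exists (@uclass R L M U UU (home L) a), (@uclass R L M U UU (home L) b); split=> //.
- by move=> n; split; [have [] := MP n|rewrite /a /b; case: cid].
- by apply: models_ultraproduct => n; have [] := MP n.
- by move=> phi; rewrite /feval2 -uenv_pair; exact: Los.
Qed.

End SequentialCompactness.

(** * Chain metrics *)

(** Nonnegativity excludes oo - oo: for [a] equal to +oo the right-hand side is +oo even if [S] is
    empty. *)
Lemma le_add_ereal_inf (R : realType) (S : set \bar R) (a c : \bar R) :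
  (0 <= a)%E -> (forall s, S s -> (0 <= s)%E) ->
  (forall s, S s -> (c <= a + s)%E) -> (c <= a + ereal_inf S)%E.
Proof.
move=> a0 S0 cS; have infS0 : (0 <= ereal_inf S)%E by exact: le_ereal_inf_tmp.
case: a a0 cS => [r| |] // _ cS.
  rewrite -leeBlDl//; apply: le_ereal_inf_tmp => s Ss.
  by rewrite leeBlDl//; exact: cS.
by rewrite addye ?leey// gt_eqF// (lt_le_trans _ infS0)// ltNy0.
Qed.

Section ChainMetric.
Context {R : realType} (X : Type) (rho : X -> X -> \bar R).
Hypothesis rho_ge0 : forall x y, (0 <= rho x y)%E.
Hypothesis rhoxx : forall x, rho x x = 0%E.
Hypothesis rhoC : forall x y, rho x y = rho y x.
Hypothesis rho_merge : forall x y z, (rho x z <= rho x y + rho y z)%E \/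
  (1 <= rho x y + rho y z)%E.
Local Open Scope ereal_scope.

(* [chain n] has [n.+1] links. *)
Fixpoint chain n (x z : X) : \bar R :=
  if n is m.+1 then ereal_inf [set rho x y + chain m y z | y in [set: X]]
  else rho x z.

Lemma chainS n x z :
  chain n.+1 x z = ereal_inf [set rho x y + chain n y z | y in [set: X]].
Proof. by []. Qed.

Arguments chain : simpl never.

(* The infimum of all the [chain n x z], see [chain_dist_le] and
   [le_chain_dist]; cutting the terms off below makes it a continuous function
   of the sequence of chain infima ([tapered_inf_continuous]). *)
Definition chain_dist (x z : X) : \bar R :=
  ereal_inf [set maxe (chain n.*2 x z) n%:R%:E | n in [set: nat]].

Lemma chain_le n x y z : chain n.+1 x z <= rho x y + chain n y z.
Proof. by apply: ereal_inf_lbound; exists y. Qed.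

Lemma le_chainS n x z c :
  (forall y, c <= rho x y + chain n y z) -> c <= chain n.+1 x z.
Proof. by move=> cn; apply: le_ereal_inf_tmp => _ [y _ <-]. Qed.

Lemma chain_ge0 n x z : 0 <= chain n x z.
Proof.
elim: n x z => [|n IH] x z; first exact: rho_ge0.
by apply: le_chainS => y; rewrite adde_ge0.
Qed.

Lemma chain_geS n x z : chain n.+1 x z <= chain n x z.
Proof. by apply: le_trans (chain_le n x x z) _; rewrite rhoxx add0e. Qed.

Lemma chain_decreasing m n x z : (m <= n)%N -> chain n x z <= chain m x z.
Proof.
elim: n => [|n IH]; first by rewrite leqn0 => /eqP ->.
rewrite leq_eqVlt => /predU1P[->//|/IH]; apply: le_trans; exact: chain_geS.
Qed.

(** Concatenation: [m.+1] links followed by [n.+1] links are [m + n + 2] links, which is index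
    [(m + n).+1]. *)
Lemma chain_triangle m n x y z :
  chain (m + n).+1 x z <= chain m x y + chain n y z.
Proof.
elim: m x => [|m IH] x; first exact: chain_le.
rewrite addeC; apply: le_add_ereal_inf; first exact: chain_ge0.
  by move=> _ [w _ <-]; rewrite adde_ge0// chain_ge0.
move=> _ [w _ <-]; apply: le_trans (chain_le _ _ w _) _.
by rewrite addeCA leeD2l// addeC IH.
Qed.

(** Chains unfold from the left, so in the reversed chain the first link is put back at the right
    end by [chain_triangle] with a one-link second part. *)
Lemma chainC n x z : chain n x z = chain n z x.
Proof.
have le_C x1 z1 : chain n z1 x1 <= chain n x1 z1.
  elim: n x1 z1 => [|n IH] x1 z1; first by rewrite /chain rhoC.
  apply: le_chainS => y; have := chain_triangle n 0 z1 y x1.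
  rewrite addn0 => /le_trans; apply.
  by rewrite [chain 0 _ _]rhoC addeC leeD2l.
by apply/eqP; rewrite eq_le !le_C.
Qed.

(* Either the first two links merge, or they cost at least 1 and the remaining
   two fewer links are treated by induction. *)
Lemma chain_merge n x z :
  mine (chain n x z) (n./2.+1%:R%:E) <= chain n.+1 x z.
Proof.
have [m] := ubnP n; elim: m n x z => // m IH [|[|n]] x z nm.
- apply: le_chainS => y; rewrite ge_min.
  by have [->|->] := rho_merge x y z; rewrite ?orbT.
- apply: le_chainS => y; rewrite ge_min.
  have := IH 0%N y z nm; rewrite ge_min => /orP[h|h].
    by rewrite (le_trans (chain_le 0 x y z))// leeD2l.
  by rewrite (le_trans h) ?orbT// leeDr.
- apply: le_chainS => y; rewrite (chainS n.+1 y); apply: le_add_ereal_inf => //.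
    by move=> _ [w _ <-]; rewrite adde_ge0// chain_ge0.
  move=> _ [w _ <-]; rewrite addeA ge_min.
  have [h|h] := rho_merge x y w.
    by rewrite (le_trans (chain_le _ x w z))// leeD2r.
  have := IH n w z (ltnW nm); rewrite ge_min => /orP[h'|h'].
    rewrite (le_trans (chain_le _ x y z))// -addeA leeD2l//.
    by rewrite (le_trans (chain_le _ y w z))// leeD2l.
  (* The two links that do not merge pay 1, exactly the growth of the cutoff when the index grows by
     2. *)
  apply/orP; right; apply: le_trans (leeD h h').
  by rewrite /= -natr1 EFinD addeC.
Qed.

(** Iterated [chain_merge]: at every index from [n.*2] on, the cutoff is at least [n.+1]. Hence
    below cost [n.+1] longer chains gain nothing over those of index [n.*2]. *)
Lemma le_chain m n x z : (n.*2 <= m)%N ->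
  mine (chain n.*2 x z) (n.+1%:R%:E) <= chain m x z.
Proof.
elim: m => [|m IH]; first by rewrite leqn0 double_eq0 => /eqP ->; rewrite ge_min lexx.
rewrite leq_eqVlt => /predU1P[<-|nm]; first by rewrite ge_min lexx.
apply: le_trans (chain_merge m x z); rewrite le_min IH//= ge_min.
rewrite lee_fin ler_nat ltnS; apply/orP; right.
by rewrite -[leqLHS]doubleK half_leq.
Qed.

Lemma chain_dist_le n x z : chain_dist x z <= chain n x z.
Proof.
have [->|] := eqVneq (chain n x z) +oo; first by rewrite leey.
have := chain_ge0 n x z; case E : (chain n x z) => [r| |]//; rewrite lee_fin => r0 _.
(* With [k] the integer part of the cost [r], the [k]-th term of [chain_dist] is at most [r]: its
   taper is [k], and the alternative cutoff [k.+1] in [le_chain] exceeds [r]. *)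
have /andP[kr rk] := truncn_itv r0; set k := Num.trunc r in kr rk.
apply: (@le_trans _ _ (maxe (chain k.*2 x z) k%:R%:E)).
  by apply: ereal_inf_lbound; exists k.
rewrite ge_max lee_fin kr andbT.
have := le_chain x z (leq_maxr n k.*2); rewrite ge_min => /orP[|] h.
  by rewrite (le_trans h)// -E chain_decreasing// leq_maxl.
have := le_trans h (chain_decreasing x z (leq_maxl n k.*2)).
by rewrite E lee_fin => /(lt_le_trans rk); rewrite ltxx.
Qed.

Lemma le_chain_dist x z c : (forall n, c <= chain n x z) -> c <= chain_dist x z.
Proof.
by move=> cn; apply: le_ereal_inf_tmp => _ [n _ <-]; rewrite le_max cn.
Qed.

Lemma chain_dist_ge0 x z : 0 <= chain_dist x z.
Proof. by apply: le_chain_dist => n; exact: chain_ge0. Qed.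

Lemma chain_dist_le_rho x z : chain_dist x z <= rho x z.
Proof. exact: (chain_dist_le 0). Qed.

(** The case [n = 0] of [le_chain]; it prevents chains from collapsing distinct points to distance
    0. *)
Lemma rho_le_chain_dist x z : mine (rho x z) 1 <= chain_dist x z.
Proof. by apply: le_chain_dist => n; exact: (@le_chain n 0). Qed.

Lemma chain_distC x z : chain_dist x z = chain_dist z x.
Proof.
by rewrite /chain_dist; congr ereal_inf; apply: eq_imagel => n _; rewrite chainC.
Qed.

Lemma chain_dist_lt_chain x z c : chain_dist x z < c -> exists n, chain n x z < c.
Proof.
by move=> /ereal_inf_lt[_ [n _ <-]]; rewrite gt_max => /andP[]; exists n.*2.
Qed.

Lemma chain_dist_triangle x y z :
  chain_dist x z <= chain_dist x y + chain_dist y z.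
Proof.
apply: le_add_ereal_inf; first exact: chain_dist_ge0.
  by move=> _ [n _ <-]; rewrite le_max chain_ge0.
move=> _ [n _ <-]; rewrite addeC; apply: le_add_ereal_inf.
- by rewrite le_max chain_ge0.
- by move=> _ [m _ <-]; rewrite le_max chain_ge0.
(* The concatenated chain has odd index, so it is not among the terms of [chain_dist];
   [chain_dist_le] covers all indices. *)
move=> _ [m _ <-]; apply: le_trans (chain_dist_le (m.*2 + n.*2).+1 x z) _.
apply: le_trans (chain_triangle _ _ x y z) _.
by rewrite addeC leeD// le_max lexx.
Qed.

(** Costs are nonnegative, so a finite total forces every link to be finite, and transitivity of [E]
    joins the links. *)
Lemma chain_fin (E : X -> X -> Prop) : (forall x y, rho x y < +oo -> E x y) ->
  (forall x y z, E x y -> E y z -> E x z) ->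
  forall n x z, chain n x z < +oo -> E x z.
Proof.
move=> rhoE Etr; elim=> [|n IH] x z; first exact: rhoE.
move=> /ereal_inf_lt[_ [y _ <-]] xyz; apply: (Etr _ y).
  by apply: rhoE; apply: le_lt_trans xyz; rewrite leeDl// chain_ge0.
by apply: IH; apply: le_lt_trans xyz; rewrite leeDr.
Qed.

End ChainMetric.

(** * Formulas *)

Lemma inf_image_le (R : realType) (I : Type) (A : set I) (f g : I -> R) (e : R) :
  has_lbound (f @` A) -> A !=set0 -> (forall i, A i -> f i <= g i + e) ->
  inf (f @` A) <= inf (g @` A) + e.
Proof.
move=> fA A0 fg; rewrite -lerBlDr; apply: lb_le_inf.
  by have [i Ai] := A0; exists (g i), i.
move=> _ [i Ai <-]; rewrite lerBlDr; apply: le_trans (fg _ Ai).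
by apply: ge_inf => //; exists i.
Qed.

(* Continuous on the product, unlike the plain infimum: all but finitely many
   terms are close to +oo whatever their arguments. *)
Definition tapered_inf (R : realType) (x : {ptws nat -> \bar R}) : \bar R :=
  ereal_inf [set maxe (x n) n%:R%:E | n in [set: nat]].

Lemma tapered_inf_continuous (R : realType) : continuous (@tapered_inf R).
Proof.
move=> x.
apply: (@cvge_contractP R _ (nbhs x) (nbhs_filter x) (@tapered_inf R) (tapered_inf x)).2.
move=> e e0.
have e2 : 0 < (e / 2) by rewrite divr_gt0.
(* From index [N] on, every tapered term has its [contract] within [e / 2] of 1, so only the first
   [N] coordinates of the argument need control. *)
have [N Ne] : exists N, (1 - e / 2 < contract (N%:R%:E : \bar R)).
  have nat_oo : (n%:R%:E : \bar R) @[n --> \oo] --> +oo%E.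
    by apply/cvgeryP; exact: cvgr_idn.
  have c_oo : contract (n%:R%:E : \bar R) @[n --> \oo] --> contract (+oo%E : \bar R).
    exact: contract_cvg.
  have le1 : 1 - e / 2 < contract (+oo%E : \bar R).
    by rewrite [ltRHS](_ : _ = 1)// gtrBl.
  by have [N _ /(_ N (leqnn N))] := cvgr_gt _ c_oo _ le1; exists N.
have max_cvg n : maxe (y n) n%:R%:E @[y --> x] --> maxe (x n) n%:R%:E.
  exact: maxe_cvg (@ptws_proj_cvg nat _ x n) (cvg_cst _).
have near_terms : nbhs x [set y : {ptws nat -> \bar R} | forall n : 'I_N,
    `|contract (maxe (x n) n%:R%:E) - contract (maxe (y n) n%:R%:E)| < e / 2].
  apply: (@filter_forall _ _ _ _ (nbhs_filter x)) => n.
  exact: (@cvge_contractP R _ (nbhs x) (nbhs_filter x)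
    (fun y => maxe (y n) n%:R%:E) _).1 (max_cvg n) _ e2.
apply: filterS near_terms => y near_y.
have close n : (`|contract (maxe (x n) n%:R%:E) - contract (maxe (y n) n%:R%:E)|
    <= e / 2).
  have [nN|Nn] := ltnP n N; first exact: ltW (near_y (Ordinal nN)).
  have big z : (1 - e / 2 < contract (maxe z n%:R%:E) <= 1).
    rewrite (lt_le_trans Ne) ?le_contract ?le_max ?lee_fin ?ler_nat ?Nn ?orbT//=.
    by have /andP[] := contract_itv (maxe z n%:R%:E).
  have [/andP[? ?] /andP[? ?]] := (big (x n), big (y n)).
  by rewrite ler_norml; apply/andP; split; lra.
have inf_le (v w : {ptws nat -> \bar R}) :
    (forall n, contract (maxe (v n) n%:R%:E) <=
      contract (maxe (w n) n%:R%:E) + e / 2) ->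
    (contract (tapered_inf v) <= contract (tapered_inf w) + e / 2).
  move=> vw; rewrite !contract_inf; [|by eexists; exists 0%N|by eexists; exists 0%N].
  rewrite !image_comp; apply: inf_image_le => [||n _]; [|by exists 0%N|exact: vw].
  by exists (- 1) => _ [n _ <-]; have /andP[] := contract_itv (maxe (v n) n%:R%:E).
apply: (@le_lt_trans _ _ (e / 2)); last by rewrite gtr_pMr// invf_lt1// ltr1n.
have xy : contract (tapered_inf x) <= contract (tapered_inf y) + e / 2.
  by apply: inf_le => n; move: (close n); rewrite ler_norml => /andP[? ?]; lra.
have yx : contract (tapered_inf y) <= contract (tapered_inf x) + e / 2.
  by apply: inf_le => n; move: (close n); rewrite ler_norml => /andP[? ?]; lra.
by rewrite ler_norml; apply/andP; split; lra.
Qed.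

Section Renaming.
Context {R : realType} {L : language R}.
Implicit Types G : seq (lsort L).

Definition renaming G G' := forall s, var G s -> var G' s.

Definition rlift G G' t (r : renaming G G') : renaming (t :: G) (t :: G') :=
  var_cons_rect (Q := fun s _ => var (t :: G') s) (@vz _ G' t)
    (fun s x => vs t (r s x)).

Fixpoint ren_term G G' (r : renaming G G') s (t : term L G s) : term L G' s :=
  match t in term _ _ s return term L G' s with
  | TVar _ x => TVar (r _ x)
  | TApp f args => TApp (fun s x => ren_term r (args s x))
  end.

Fixpoint ren G (phi : formula L G) : forall G', renaming G G' -> formula L G' :=
  match phi in formula _ G return forall G', renaming G G' -> formula L G' with
  | FDist _ _ t1 t2 => fun G' r => FDist (ren_term r t1) (ren_term r t2)
  | FPred _ P args => fun G' r => FPred (fun s x => ren_term r (args s x))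
  | FConn _ u uC phis => fun G' r => FConn uC (fun n => ren (phis n) r)
  | FSup _ s psi => fun G' r => FSup (ren psi (rlift r))
  | FInf _ s psi => fun G' r => FInf (ren psi (rlift r))
  end.

Lemma teval_ren (M : structure L) G G' (r : renaming G G')
    (v : env (carrier M) G') s (t : term L G s) :
  teval v (ren_term r t) = teval (fun s x => v s (r s x)) t.
Proof.
elim: t => [//|f args IH] /=; congr finterp.
by apply: env_ext => s0 x; exact: IH.
Qed.

Lemma econs_rlift (M : structure L) G G' t (r : renaming G G')
    (v : env (carrier M) G') (a : M t) :
  (fun s x => econs (carrier M) a v s (rlift r x)) =
  econs (carrier M) a (fun s x => v s (r s x)).
Proof. by apply: env_ext; apply: var_cons_rect. Qed.

Lemma feval_ren (M : structure L) G (phi : formula L G) G' (r : renaming G G')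
    (v : env (carrier M) G') :
  feval (ren phi r) v = feval phi (fun s x => v s (r s x)).
Proof.
elim: phi G' r v => {G} [G s t1 t2|G P args|G u uC phis IH|G s psi IH|G s psi IH]
  G' r v /=.
- by rewrite !teval_ren.
- by congr pinterp; apply: env_ext => s x; exact: teval_ren.
- by congr u; apply/funext => n; exact: IH.
- by congr ereal_sup; apply: eq_imagel => a _; rewrite IH econs_rlift.
- by congr ereal_inf; apply: eq_imagel => a _; rewrite IH econs_rlift.
Qed.

End Renaming.

Section BinaryFormulas.
Context {R : realType} {L : language R}.
Let h := home L.
Let H := [:: h; h].

Definition rename2 G (x y : var G h) : renaming (L := L) H G :=
  var_cons_rect (Q := fun s _ => var G s) x
    (var_cons_rect (Q := fun s _ => var G s) y
      (fun s z => False_rect _ (var_nil z))).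

Lemma feval_rename2 (M : structure L) G (phi : formula L H) (x y : var G h)
    (v : env (carrier M) G) :
  feval (ren phi (rename2 x y)) v = feval2 phi (v _ x) (v _ y).
Proof. by rewrite feval_ren /feval2; congr feval; rewrite [LHS]env_pair. Qed.

Definition distance : formula L H :=
  FDist (TVar (@vz _ _ h)) (TVar (vs h (@vz _ _ h))).


Definition flip (phi : formula L H) : formula L H :=
  ren phi (rename2 (vs h (@vz _ _ h)) (@vz _ _ h)).

Lemma feval_flip (M : structure L) (phi : formula L H) (a b : M h) :
  feval2 (flip phi) a b = feval2 phi b a.
Proof. by rewrite [LHS]feval_rename2. Qed.

Local Open Scope ereal_scope.

(* Truncation at 0 avoids oo - oo, where addition is not continuous. *)
Lemma plus_continuous :
  continuous (fun x : {ptws nat -> \bar R} => maxe (x 0%N) 0 + maxe (x 1%N) 0).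
Proof.
move=> x.
have max0_cvg n : maxe (y n) 0 @[y --> x] --> maxe (x n) 0.
  exact: maxe_cvg (@ptws_proj_cvg nat _ x n) (cvg_cst _).
have max0_def : maxe (x 0%N) 0 +? maxe (x 1%N) 0.
  by apply: ge0_adde_def; rewrite inE le_max lexx orbT.
have plus_cvg := @cvgeD {ptws nat -> \bar R} (nbhs x) (nbhs_filter x) R
  (fun y => maxe (y 0%N) 0) (fun y => maxe (y 1%N) 0) _ _ max0_def.
exact: plus_cvg (max0_cvg 0%N) (max0_cvg 1%N).
Qed.

Definition fplus G (phi psi : formula L G) : formula L G :=
  FConn plus_continuous (fun n => if n is 0 then phi else psi).

(** Under the quantifier the variables are, in order, the intermediate point, the left end and the
    right end. *)
Definition compose (phi psi : formula L H) : formula L H :=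
  FInf (fplus (ren phi (rename2 (vs h (@vz _ _ h)) (@vz _ _ h)))
    (ren psi (rename2 (@vz _ _ h) (vs h (vs h (@vz _ _ h)))))).

Lemma feval_compose (M : structure L) (phi psi : formula L H) :
  (forall a b : M h, (0 <= feval2 phi a b)%E) ->
  (forall a b : M h, (0 <= feval2 psi a b)%E) ->
  forall a c : M h, feval2 (compose phi psi) a c =
  ereal_inf [set (feval2 phi a b + feval2 psi b c)%E | b in [set: M h]].
Proof.
move=> phi0 psi0 a c; rewrite /feval2 /=; congr ereal_inf.
apply: eq_imagel => b _.
by rewrite !feval_rename2 !max_l// ?phi0 ?psi0.
Qed.

Fixpoint fchain (rho : formula L H) n : formula L H :=
  if n is m.+1 then compose rho (fchain rho m) else rho.

Lemma feval_fchain (M : structure L) (rho : formula L H) :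
  (forall a b : M h, (0 <= feval2 rho a b)%E) ->
  forall n (a b : M h), feval2 (fchain rho n) a b = chain (feval2 rho (M := M)) n a b.
Proof.
move=> rho0; elim=> [//|n IH] a b /=.
have chain0 c e : 0 <= feval2 (M := M) (fchain rho n) c e.
  by rewrite IH; exact: chain_ge0.
by rewrite feval_compose//; congr ereal_inf; apply: eq_imagel => c _; rewrite IH.
Qed.

Definition fchain_dist (rho : formula L H) : formula L H :=
  FConn (@tapered_inf_continuous R) (fun n => fchain rho n.*2).

Lemma feval_fchain_dist (M : structure L) (rho : formula L H) :
  (forall a b : M h, (0 <= feval2 rho a b)%E) ->
  forall a b : M h, feval2 (fchain_dist rho) a b = chain_dist (feval2 rho (M := M)) a b.
Proof.
move=> rho0 a b; rewrite /feval2 /=; congr ereal_inf.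
by apply: eq_imagel => n _; rewrite -feval_fchain.
Qed.

End BinaryFormulas.

(** * Open sets of types *)

Lemma sup_image_le (R : realType) (I : Type) (A : set I) (f g : I -> R) (e : R) :
  has_ubound (g @` A) -> 0 <= e -> (forall i, A i -> f i <= g i + e) ->
  sup (f @` A) <= sup (g @` A) + e.
Proof.
move=> gA e0 fg; have [->|/set0P[i0 Ai0]] := eqVneq A set0.
  by rewrite !image_set0 sup0 add0r.
apply: ge_sup; first by exists (f i0), i0.
move=> _ [i Ai <-]; apply: le_trans (fg _ Ai) _; rewrite lerD2r.
by apply: ub_le_sup => //; exists i.
Qed.

Section CoordinateDistance.
Context {R : realType}.
Implicit Types x y q : {ptws nat -> \bar R}.

(** A metric for the product topology: truncation at [n.+1%:R^-1] makes the tail uniformly small,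
    while a distance below that bound controls coordinate [n]. *)
Definition coord_dist x y : R :=
  sup [set Num.min `|contract (x n) - contract (y n)| n.+1%:R^-1 | n in [set: nat]].

Lemma ubound_coord_dist x y : ubound
  [set Num.min `|contract (x n) - contract (y n)| n.+1%:R^-1 | n in [set: nat]] 1.
Proof.
by move=> _ [n _ <-]; rewrite ge_min invf_le1// ler1n orbT.
Qed.

Lemma has_ubound_coord_dist x y : has_ubound
  [set Num.min `|contract (x n) - contract (y n)| n.+1%:R^-1 | n in [set: nat]].
Proof. by exists 1; exact: ubound_coord_dist. Qed.

Lemma coord_dist_le1 x y : coord_dist x y <= 1.
Proof. by apply: ge_sup; [eexists; exists 0|exact: ubound_coord_dist]. Qed.

Lemma le_coord_dist x y n :
  Num.min `|contract (x n) - contract (y n)| n.+1%:R^-1 <= coord_dist x y.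
Proof. by apply: ub_le_sup; [exact: has_ubound_coord_dist|exists n]. Qed.

Lemma coord_dist_ge0 x y : 0 <= coord_dist x y.
Proof. by apply: le_trans (le_coord_dist x y 0); rewrite le_min normr_ge0 invr_ge0/=. Qed.

Lemma coord_distxx x : coord_dist x x = 0.
Proof.
apply/eqP; rewrite eq_le coord_dist_ge0 andbT; apply: ge_sup; first by eexists; exists 0.
by move=> _ [n _ <-]; rewrite ge_min subrr normr0 lexx.
Qed.

Lemma coord_dist_le x y q (e : R) : 0 <= e ->
  (forall n, `|contract (x n) - contract (y n)| <= e \/ n.+1%:R^-1 <= e) ->
  coord_dist x q <= coord_dist y q + e.
Proof.
move=> e0 xy; apply: sup_image_le => // [|n _]; first exact: has_ubound_coord_dist.
have [h|h] := xy n.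
  have min_le (u v w i : R) : w <= e -> u <= w + v -> Num.min u i <= Num.min v i + e.
    by move=> we uwv; rewrite /Num.min; case: (ltP u) => ?; case: (ltP v) => ?; lra.
  exact: min_le h (ler_distD _ _ _).
rewrite ge_min; apply/orP; right; apply: le_trans h _.
by rewrite lerDr le_min normr_ge0 invr_ge0 ler0n.
Qed.

(* For [Q] empty the supremum is [0], which is the right value. *)
Definition closeness (Q : set {ptws nat -> \bar R}) x : R :=
  sup [set 1 - coord_dist x q | q in Q].

Lemma has_ubound_closeness Q x : has_ubound [set 1 - coord_dist x q | q in Q].
Proof. by exists 1 => _ [q _ <-]; rewrite gerBl coord_dist_ge0. Qed.

Lemma closeness_itv Q x : 0 <= closeness Q x <= 1.
Proof.
have [Q0|/set0P[q Qq]] := eqVneq Q set0.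
  by rewrite /closeness Q0 image_set0 sup0 lexx ler01.
apply/andP; split.
  apply: (@le_trans _ _ (1 - coord_dist x q)); last first.
    by apply: ub_le_sup; [exact: has_ubound_closeness|exists q].
  by rewrite subr_ge0 coord_dist_le1.
apply: ge_sup; first by eexists; exists q.
by move=> _ [r _ <-]; rewrite gerBl coord_dist_ge0.
Qed.

(** [closeness Q] is 1-Lipschitz for [coord_dist], which finitely many coordinates control up to
    [e / 2]; [expand] is undone by [contract] on values in [0, 1]. *)
Lemma closeness_continuous Q :
  continuous (fun x : {ptws nat -> \bar R} => expand (closeness Q x)).
Proof.
move=> x.
apply: (@cvge_contractP R _ (nbhs x) (nbhs_filter x)
  (fun x : {ptws nat -> \bar R} => expand (closeness Q x)) _).2 => e e0.
have e2 : 0 < e / 2 by rewrite divr_gt0.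
have [N Ne] : exists N, N.+1%:R^-1 < e / 2.
  have [N _ /(_ N (leqnn N))] := near_infty_natSinv_lt (PosNum e2).
  by exists N.
have near_coord : nbhs x [set y : {ptws nat -> \bar R} | forall n : 'I_N,
    `|contract (x n) - contract (y n)| < e / 2].
  apply: (@filter_forall _ _ _ _ (nbhs_filter x)) => n.
  exact: (@cvge_contractP R _ (nbhs x) (nbhs_filter x)
    (fun y : {ptws nat -> \bar R} => y n) _).1 (@ptws_proj_cvg nat _ x n) _ e2.
apply: filterS near_coord => y near_y.
have close n : `|contract (x n) - contract (y n)| <= e / 2 \/ n.+1%:R^-1 <= e / 2.
  have [nN|Nn] := ltnP n N; first by left; exact: ltW (near_y (Ordinal nN)).
  by right; apply: le_trans (ltW Ne); rewrite lef_pV2 ?posrE// ler_nat ltnS.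
have lip v w : (forall n, `|contract (v n) - contract (w n)| <= e / 2 \/
    n.+1%:R^-1 <= e / 2) -> closeness Q v <= closeness Q w + e / 2.
  move=> vw; apply: sup_image_le => [|//|q _]; [exact: has_ubound_closeness|exact: ltW|].
  have wv : coord_dist w q <= coord_dist v q + e / 2.
    by apply: coord_dist_le (ltW e2) _ => n; rewrite distrC.
  by lra.
have xy := lip _ _ close.
have yx : closeness Q y <= closeness Q x + e / 2.
  by apply: lip => n; rewrite distrC.
have norm1 z : `|closeness Q z| <= 1.
  by have /andP[? ?] := closeness_itv Q z; rewrite ger0_norm.
by rewrite !expandK ?inE// ltr_norml; apply/andP; split; lra.
Qed.

End CoordinateDistance.

Section SeparatingFormula.
Context {R : realType} {L : language R} (T : theory L).
Let H := [:: home L; home L].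

(** [expand] sends 1 to +oo, so the formula is infinite where the closeness to the complement of [E]
    equals 1. That happens on the complement, and at a point of [E] it would make types outside [E]
    converge to it, against openness. *)
Lemma separating_formula (E : set (S2 T)) :
  separable_language L -> open E ->
  exists phi : formula L H, forall (M : structure L) (MT : models M T)
    (a b : M (home L)), (0 <= feval2 phi a b)%E /\
    ((feval2 phi a b < +oo)%E <-> E (tp2 MT a b)).
Proof.
move=> /(_ H)[D Ddense] oE.
pose coords (p : S2 T) : {ptws nat -> \bar R} := fun n => set_val p (D n).
pose Q := [set coords p | p in ~` E].
exists (FConn (@closeness_continuous R Q) D) => M MT a b.
have -> : feval2 (FConn (@closeness_continuous R Q) D) a b =
  expand (closeness Q (coords (tp2 MT a b))) by [].
set p := tp2 MT a b; have /andP[cl0 cl1] := closeness_itv Q (coords p).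
split; first by rewrite -expand0 le_expand.
rewrite ltey expand_eqoo -ltNge; split=> [lt1|Ep].
  apply: contrapT => nEp; move: lt1; rewrite ltNge => /negP; apply.
  rewrite -[leLHS]subr0 -(coord_distxx (coords p)).
  apply: ub_le_sup; first exact: has_ubound_closeness.
  by exists (coords p) => //; exists p.
rewrite ltNge; apply/negP => clge1.
have near_q n : exists q, ~ E q /\ coord_dist (coords p) (coords q) < n.+1%:R^-1.
  have supQ : has_sup [set 1 - coord_dist (coords p) q | q in Q].
    split; last exact: has_ubound_closeness.
    apply/set0P/eqP => Q0; move: clge1.
    by rewrite /closeness Q0 sup0 ler10.
  have inv_gt0 : 0 < n.+1%:R^-1 :> R by rewrite invr_gt0.
  have [_ [_ [q nEq <-] <-]] := sup_adherent inv_gt0 supQ.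
  rewrite -/(closeness Q _) => lt_n; exists q; split=> //.
  by rewrite -ltrN2 -(ltrD2l 1); apply: le_lt_trans lt_n; rewrite lerD2r.
have [q qP] := choice near_q.
have qp : q @ \oo --> p.
  apply/cvg_initialP; apply/cvg_ptwsP => phi.
  apply/cvge_contractP => e e0; have e3 : 0 < e / 3 by rewrite divr_gt0.
  have [k phik] := Ddense phi _ e3.
  (* Density of [D] is uniform over all structures, so one coordinate [k] approximates [phi] at
     every type; this turns convergence of coordinates into convergence of types. *)
  have close (r : S2 T) : `|contract (set_val r phi) - contract (coords r k)| <= e / 3.
    case: r => r rT; have [X XT [v rE]] := set_mem rT.
    by rewrite /coords /set_val /= rE; exact: phik.
  suff : \forall n \near \oo,
    `|contract (set_val p phi) - contract (set_val (q n) phi)| < e by [].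
  near=> n; have k_n : (k <= n)%N by near: n; exists k.
  have n_e : n.+1%:R^-1 < e / 3 by near: n; exact: near_infty_natSinv_lt (PosNum e3).
  have [_ qn] := qP n.
  have coords_n : `|contract (coords p k) - contract (coords (q n) k)| < e / 3.
    have := le_lt_trans (le_coord_dist (coords p) (coords (q n)) k) qn.
    rewrite gt_min => /orP[/lt_trans|]; first exact.
    by rewrite ltf_pV2 ?posrE// ltr_nat ltnS ltnNge k_n.
  have := close p; have := close (q n).
  move: coords_n => /ltr_normlP[? ?] /ler_normlP[? ?] /ler_normlP[? ?].
  by apply/ltr_normlP; split; lra.
have /= := qp E (open_nbhs_nbhs (conj oE Ep)).
by move=> [n _ /(_ n (leqnn n))]; have [] := qP n.
Unshelve. all: by end_near. Qed.

End SeparatingFormula.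

(** * Compactness and uniqueness *)

Section Compactness.
Context {R : realType} {L : language R} (T : theory L).
Let H := [:: home L; home L].
Implicit Types (phi d : formula L H) (M : structure L).

Lemma invS_cvge (U : set_system nat) : \oo `<=` U ->
  (n.+1%:R^-1%:E : \bar R) @[n --> U] --> 0%E.
Proof.
move=> oU; have inv_oo : (n.+1%:R^-1%:E : \bar R) @[n --> \oo] --> 0%E.
  by apply: cvg_EFin; [exact: nearW|exact: cvg_harmonic].
by move=> A /inv_oo /oU.
Qed.

Lemma natr_cvge (U : set_system nat) : \oo `<=` U ->
  (n%:R%:E : \bar R) @[n --> U] --> +oo%E.
Proof.
move=> oU; have nat_oo : (n%:R%:E : \bar R) @[n --> \oo] --> +oo%E.
  by apply/cvgeryP; exact: cvgr_idn.
by move=> A /nat_oo /oU.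
Qed.

(** Otherwise pairs at distance below [n.+1%:R^-1] with value above [n] have a limit pair that is
    diagonal and has value +oo. Using one index for both bounds lets a single [N] set the scale and
    the shift of [gauge]. *)
Lemma bounded_near_diagonal phi :
  (forall M, models M T -> forall a : M (home L), (feval2 phi a a < +oo)%E) ->
  exists N, forall M, models M T -> forall a b : M (home L),
    mdist a b < N.+1%:R^-1 -> (feval2 phi a b <= N%:R%:E)%E.
Proof.
move=> phi_diag; apply: contrapT => /forallNP unbounded.
pose Q n (M : structure L) (a b : M (home L)) : Prop :=
  mdist a b < n.+1%:R^-1 /\ (n%:R%:E < feval2 phi a b)%E.
have QM n : exists2 M : structure L, models M T & exists a b, Q n M a b.
  have /existsNP[M /not_implyP[MT /existsNP[a /existsNP[b]]]] := unbounded n.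
  by move=> /not_implyP[ab /negP]; rewrite -ltNge => ?; exists M => //; exists a, b.
have [M [a [b [U [N [c [e [UU oU MP NT lim]]]]]]]] :=
  sequential_compactness QM.
have PU : ProperFilter U := ultra_proper.
have ce : c = e.
  apply: mdist_positivity; apply/eqP; rewrite eq_le mdist_ge0 andbT.
  have := lee_cvg_filter (lim distance) (invS_cvge oU); rewrite lee_fin; apply.
  by apply: nearW => n; have [_ [/ltW]] := MP n.
have := phi_diag N NT c; rewrite ltNge => /negP; apply; rewrite {2}ce.
apply: lee_cvg_filter (natr_cvge oU) (lim phi) _.
by apply: nearW => n; have [_ [_ /ltW]] := MP n.
Qed.

(** A limit of counterexamples has [d] equal to 0, so its two points coincide, while [d'] stays at
    least [e]. *)
Lemma metric_small_control d d' (e : R) : 0 < e ->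
  definable_generalised_metric T d -> definable_generalised_metric T d' ->
  exists n, forall M, models M T -> forall x y : M (home L),
    (feval2 d x y < n.+1%:R^-1%:E)%E -> (feval2 d' x y < e%:E)%E.
Proof.
move=> e0 dP d'P; apply: contrapT => /forallNP uncontrolled.
pose Q n (M : structure L) (a b : M (home L)) : Prop :=
  (feval2 d a b < n.+1%:R^-1%:E)%E /\ (e%:E <= feval2 d' a b)%E.
have QM n : exists2 M : structure L, models M T & exists a b, Q n M a b.
  have /existsNP[M /not_implyP[MT /existsNP[a /existsNP[b]]]] := uncontrolled n.
  by move=> /not_implyP[ab /negP]; rewrite -leNgt => ?; exists M => //; exists a, b.
have [M [a [b [U [N [x [y [UU oU MP NT lim]]]]]]]] :=
  sequential_compactness QM.
have PU : ProperFilter U := ultra_proper.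
have [d_ge0 d_eq0 _ _] := dP N NT; have [_ d'_eq0 _ _] := d'P N NT.
have xy : x = y.
  apply/d_eq0/eqP; rewrite eq_le d_ge0 andbT.
  apply: lee_cvg_filter (lim d) (invS_cvge oU) _.
  by apply: nearW => n; have [_ [/ltW]] := MP n.
have : (e%:E <= feval2 d' x y)%E.
  apply: lee_cvg_filter (cvg_cst _) (lim d') _.
  by apply: nearW => n; have [_ []] := MP n.
by rewrite (d'_eq0 x y).2// lee_fin leNgt e0.
Qed.

(** A limit of counterexamples has [d] infinite and [d'] at most [r], yet both are finite on the
    same set [E]. *)
Lemma metric_large_control d d' (E : set (S2 T)) (r : R) :
  finite_exactly_on d E -> finite_exactly_on d' E ->
  exists n, forall M, models M T -> forall x y : M (home L),
    (n%:R%:E < feval2 d x y)%E -> (r%:E < feval2 d' x y)%E.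
Proof.
move=> dE d'E; apply: contrapT => /forallNP uncontrolled.
pose Q n (M : structure L) (a b : M (home L)) : Prop :=
  (n%:R%:E < feval2 d a b)%E /\ (feval2 d' a b <= r%:E)%E.
have QM n : exists2 M : structure L, models M T & exists a b, Q n M a b.
  have /existsNP[M /not_implyP[MT /existsNP[a /existsNP[b]]]] := uncontrolled n.
  by move=> /not_implyP[ab /negP]; rewrite -leNgt => ?; exists M => //; exists a, b.
have [M [a [b [U [N [x [y [UU oU MP NT lim]]]]]]]] :=
  sequential_compactness QM.
have PU : ProperFilter U := ultra_proper.
have : (feval2 d' x y < +oo)%E.
  apply: (@le_lt_trans _ _ r%:E); last exact: ltry.
  apply: lee_cvg_filter (lim d') (cvg_cst _) _.
  by apply: nearW => n; have [_ []] := MP n.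
move=> /(d'E N NT)/(dE N NT); rewrite ltNge => /negP; apply.
apply: lee_cvg_filter (natr_cvge oU) (lim d) _.
by apply: nearW => n; have [_ [/ltW]] := MP n.
Qed.

Lemma metrics_unif_coarse_controls d d' (E : set (S2 T)) :
  definable_generalised_metric T d -> finite_exactly_on d E ->
  definable_generalised_metric T d' -> finite_exactly_on d' E ->
  unif_coarse_controls T d d'.
Proof.
move=> dP dE d'P d'E e e0.
have [n small] := metric_small_control e0 dP d'P.
have [m large] := metric_large_control (1 / e) dE d'E.
have inv_gt0 k : 0 < k.+1%:R^-1 :> R by rewrite invr_gt0.
(* The second entry makes [1 / delta] at least [m.+1], hence above the threshold [m] of [large]. *)
exists (Num.min n.+1%:R^-1 m.+1%:R^-1); first by rewrite lt_min !inv_gt0.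
move=> M MT x y; split=> [xy|xy]; [apply: small => //|apply: large => //].
  by apply: lt_le_trans xy _; rewrite lee_fin ge_min lexx.
apply: le_lt_trans xy; rewrite lee_fin div1r (@le_trans _ _ m.+1%:R) ?ler_nat//.
by rewrite -[leLHS]invrK lef_pV2 ?posrE ?lt_min ?inv_gt0// ge_min lexx orbT.
Qed.

End Compactness.

(** * Existence *)

Section CoarseGauge.
Context {R : realType}.
Local Open Scope ereal_scope.

(* The arguments stand for dist(a, b), phi(a, b) and phi(b, a). *)
Definition gauge (N : nat) (x : {ptws nat -> \bar R}) : \bar R :=
  maxe (N.+1%:R%:E * x 0%N) 0 + (maxe (maxe (x 1%N) (x 2%N)) N%:R%:E - N%:R%:E).

Lemma maxe_sub_ge0 (y : \bar R) (r : R) : 0 <= maxe y r%:E - r%:E.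
Proof. by rewrite leeBrDr// add0e le_max lexx orbT. Qed.

(** Addition is continuous away from oo - oo. The truncation at 0 and the maximum with the finite
    [N] keep both summands nonnegative for arbitrary arguments, not only those arising in models. *)
Lemma gauge_continuous N : continuous (gauge N).
Proof.
move=> x.
have proj n := @ptws_proj_cvg nat (\bar R) x n.
have linear_cvg : maxe (N.+1%:R%:E * y 0%N) 0 @[y --> x] -->
    maxe (N.+1%:R%:E * x 0%N) 0.
  exact: maxe_cvg (cvgeZl _ (proj 0%N)) (cvg_cst _).
have max_cvg : maxe (maxe (y 1%N) (y 2%N)) N%:R%:E @[y --> x] -->
    maxe (maxe (x 1%N) (x 2%N)) N%:R%:E.
  exact: maxe_cvg (maxe_cvg (proj 1%N) (proj 2%N)) (cvg_cst _).
have shift_def : maxe (maxe (x 1%N) (x 2%N)) N%:R%:E +? - N%:R%:E.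
  by rewrite fin_num_adde_defl.
have shift_cvg := @cvgeD {ptws nat -> \bar R} (nbhs x) (nbhs_filter x) R
  (fun y => maxe (maxe (y 1%N) (y 2%N)) N%:R%:E) (fun=> - N%:R%:E) _ _
  shift_def max_cvg (cvg_cst _).
have gauge_def : maxe (N.+1%:R%:E * x 0%N) 0 +?
    (maxe (maxe (x 1%N) (x 2%N)) N%:R%:E - N%:R%:E).
  by apply: ge0_adde_def; rewrite inE ?maxe_sub_ge0// le_max lexx orbT.
have gauge_cvg := @cvgeD {ptws nat -> \bar R} (nbhs x) (nbhs_filter x) R
  (fun y => maxe (N.+1%:R%:E * y 0%N) 0)
  (fun y => maxe (maxe (y 1%N) (y 2%N)) N%:R%:E - N%:R%:E) _ _ gauge_def.
exact: gauge_cvg linear_cvg (shift_cvg (nbhs_filter x)).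
Qed.

Context {L : language R}.
Let H := [:: home L; home L].

Definition fgauge (N : nat) (phi : formula L H) : formula L H :=
  FConn (@gauge_continuous N)
    (fun n => if n is n'.+1 then (if n' is 0%N then phi else flip phi) else distance).

Lemma feval_fgauge (M : structure L) N phi (a b : M (home L)) :
  feval2 (fgauge N phi) a b = (N.+1%:R * mdist a b)%:E +
    (maxe (maxe (feval2 phi a b) (feval2 phi b a)) N%:R%:E - N%:R%:E).
Proof.
rewrite -(feval_flip phi a b) -[LHS]/(maxe ((N.+1%:R * mdist a b)%:E) 0 +
  (maxe (maxe (feval2 phi a b) (feval2 (flip phi) a b)) N%:R%:E - N%:R%:E)).
by rewrite max_l// lee_fin mulr_ge0// mdist_ge0.
Qed.

Section Properties.
Context (N : nat) (phi : formula L H) (M : structure L).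
Hypothesis phi_small : forall a b : M (home L),
  (mdist a b < N.+1%:R^-1)%R -> feval2 phi a b <= N%:R%:E.
Implicit Types a b c : M (home L).

Local Notation rho := (feval2 (fgauge N phi) (M := M)).

Lemma gauge_ge_dist a b : (N.+1%:R * mdist a b)%:E <= rho a b.
Proof. by rewrite feval_fgauge leeDl// maxe_sub_ge0. Qed.

Lemma gauge_ge0 a b : 0 <= rho a b.
Proof. by apply: le_trans (gauge_ge_dist a b); rewrite lee_fin mulr_ge0// mdist_ge0. Qed.

Lemma gaugeC a b : rho a b = rho b a.
Proof. by rewrite !feval_fgauge metric_sym (maxC (feval2 phi a b)). Qed.

(** At this scale [phi_small] applies in both orders, so the maximum is [N] and the shifted part
    vanishes. *)
Lemma gauge_small a b : (N.+1%:R * mdist a b < 1)%R ->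
  rho a b = (N.+1%:R * mdist a b)%:E.
Proof.
rewrite mulrC -ltr_pdivlMr ?ltr0n// div1r => ab.
rewrite feval_fgauge mulrC max_r ?subee ?adde0// ge_max !phi_small//.
by rewrite metric_sym.
Qed.

Lemma gaugexx a : rho a a = 0.
Proof. by rewrite gauge_small mdistxx mulr0. Qed.

Lemma gauge_eq0 a b : rho a b = 0 -> a = b.
Proof.
move=> ab0; have := gauge_ge_dist a b; rewrite ab0 lee_fin pmulr_rle0// => ab.
by apply: mdist_positivity; apply/eqP; rewrite eq_le ab mdist_ge0.
Qed.

(** If the two scaled distances add up to at least 1, so do the costs. Otherwise the scaled distance
    from [a] to [c] is below 1, where [gauge_small] identifies it with the cost. *)
Lemma gauge_merge a b c :
  rho a c <= rho a b + rho b c \/ 1 <= rho a b + rho b c.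
Proof.
have dist_le : (N.+1%:R * mdist a b + N.+1%:R * mdist b c)%:E <= rho a b + rho b c.
  by rewrite EFinD leeD// gauge_ge_dist.
have tri : (N.+1%:R * mdist a c <= N.+1%:R * mdist a b + N.+1%:R * mdist b c)%R.
  by rewrite -mulrDr ler_pM2l// metric_triangle.
have [big|small] := leP 1%R (N.+1%:R * mdist a b + N.+1%:R * mdist b c)%R.
  by right; apply: le_trans dist_le; rewrite lee_fin.
left; rewrite gauge_small ?(le_lt_trans tri)//.
by apply: le_trans dist_le; rewrite lee_fin.
Qed.

Lemma gauge_fin a b :
  (rho a b < +oo) <-> (feval2 phi a b < +oo /\ feval2 phi b a < +oo).
Proof.
have shift_fin : (maxe (maxe (feval2 phi a b) (feval2 phi b a)) N%:R%:E -
    N%:R%:E < +oo) = (feval2 phi a b < +oo) && (feval2 phi b a < +oo).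
  by rewrite lteBlDr// addye// !gt_max ltry andbT.
rewrite feval_fgauge; split=> [fin|/andP].
  apply/andP; rewrite -shift_fin; apply: le_lt_trans fin.
  by rewrite leeDr// lee_fin mulr_ge0// mdist_ge0.
by rewrite -shift_fin; apply: lte_add_pinfty; exact: ltry.
Qed.

End Properties.

End CoarseGauge.

Theorem theorem2p7 (R : realType) (L : language R) (T : theory L)
    (E : set (S2 T)) :
  separable_language L ->
  open E ->
  invariant_equivalence E ->
  (exists d : formula L [:: home L; home L],
     definable_generalised_metric T d /\ finite_exactly_on d E) /\
  (forall d d' : formula L [:: home L; home L],
     definable_generalised_metric T d -> finite_exactly_on d E ->
     definable_generalised_metric T d' -> finite_exactly_on d' E ->
     unif_coarse_controls T d d' /\ unif_coarse_controls T d' d).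
Proof.
move=> sepL oE eqE; split; last first.
  move=> d d' dP dE d'P d'E.
  by split; [exact: metrics_unif_coarse_controls dP dE d'P d'E
            |exact: metrics_unif_coarse_controls d'P d'E dP dE].
have [phi phiP] := separating_formula sepL oE.
(* Reflexivity of [E] makes [phi] finite on the diagonal. *)
have [N phi_small] : exists N, forall M, models M T -> forall a b : M (home L),
    mdist a b < N.+1%:R^-1 -> (feval2 phi a b <= N%:R%:E)%E.
  apply: bounded_near_diagonal => M MT a.
  by apply/(phiP M MT a a).2; have [+ _ _] := eqE M MT; apply.
exists (fchain_dist (fgauge N phi)); split=> [M MT|M MT a b].
  have rho0 := gauge_ge0 N phi (M := M).
  have rhoxx := gaugexx (phi_small M MT).
  have rhoC := gaugeC N phi (M := M).
  have rhoM := gauge_merge (phi_small M MT).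
  split=> [a b|a b|a b|a b c]; rewrite !feval_fchain_dist//.
  - exact: chain_dist_ge0.
  - split=> [ab0|->]; last first.
      apply/eqP; rewrite eq_le chain_dist_ge0// andbT.
      by have := chain_dist_le_rho rho0 rhoxx rhoM b b; rewrite rhoxx.
    have := rho_le_chain_dist rho0 rhoM a b.
    rewrite ab0 ge_min [(1 <= 0)%E]lee_fin ler10 orbF => rho_le0.
    have rho_eq0 : feval2 (fgauge N phi) a b = 0%E.
      by apply/eqP; rewrite eq_le rho_le0 rho0.
    exact: gauge_eq0 rho_eq0.
  - exact: chain_distC.
  - exact: chain_dist_triangle.
have rho0 := gauge_ge0 N phi (M := M).
have [Erefl Esym Etr] := eqE M MT.
(* The gauge is finite only if [phi] is finite in both orders; symmetry of [E] supplies the second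
   one. *)
have rhoE c e : (feval2 (fgauge N phi) c e < +oo)%E <-> E (tp2 MT c e).
  rewrite gauge_fin; split=> [[/(phiP M MT c e).2]//|ce].
  by split; apply/(phiP M MT _ _).2 => //; exact: Esym.
rewrite feval_fchain_dist//; split=> [|/rhoE ab].
  have rho_lt c e : (feval2 (fgauge N phi) c e < +oo)%E -> E (tp2 MT c e).
    by move=> /rhoE.
  move=> ab; have [n chain_ab] := chain_dist_lt_chain ab; move: chain_ab.
  exact: (@chain_fin R _ (feval2 (fgauge N phi) (M := M)) rho0
    (fun c e => E (tp2 MT c e)) rho_lt Etr n a b).
apply: le_lt_trans ab.
exact: chain_dist_le_rho rho0 (gaugexx (phi_small M MT))
  (gauge_merge (phi_small M MT)) a b.
Qed.
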